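(* Let $p$ be a prime with $p\equiv 3\pmod 4$ and $p>3$, and let $\zeta_p$ be a primitive $p$-th root of unity. Let $C_p$ be the $\frac{p-1}{2}\times\frac{p-1}{2}$ matrix $$C_p=\left(\frac{1-\zeta_p^{j^2k^2}}{1-\zeta_p^{j^2}}\right)_{1\le j,k\le (p-1)/2}$$ and let $S(p)$ be the $\frac{p-1}{2}\times\frac{p-1}{2}$ matrix $$S(p)=\left(\left(\frac{j^2+k^2}{p}\right)\right)_{1\le j,k\le (p-1)/2},$$ where $\left(\frac{\cdot}{p}\right)$ is the Legendre symbol. Then we may write $$\det[C_p]=(-1)^{\frac{h(-p)+1}{2}}\left(a_p+b_p\,i\sqrt{p}\right)$$ with $a_p,b_p\in\frac12\mathbb{Z}$ and $$\begin{cases}\nu_p(a_p)=\nu_p(b_p)=\frac{p-3}{8}&\text{if } p\equiv 3\pmod 8,\\ \nu_p(a_p)=\nu_p(b_p)+1=\frac{p+1}{8}&\text{if } p\equiv 7\pmod 8.\end{cases}$$ Meanwhile, $$2^{\frac{p+1}{2}}a_pb_p=(-1)^{\frac{p+1}{4}}p^{\frac{p-3}{4}}\det[S(p)]$$ and $$2^{\frac{p-1}{2}}(a_p^2-pb_p^2)=\frac{p-1}{2}(-p)^{\frac{p-3}{4}}\det[S(p)].$$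
   Context: Here $h(-p)$ denotes the class number of the field $\mathbb{Q}(\sqrt{-p})$, $\nu_p(x)$ denotes the $p$-adic order of a $p$-adic integer $x$, $i$ is the imaginary unit, and $\frac12\mathbb{Z}=\{n/2: n\in\mathbb{Z}\}$.
   Formalization: The identity for 2^{(p+1)/2} a_p b_p fails for some primitive roots (conjugating ζ_p flips b_p only); with ζ_p = e^{2πir/p} its right-hand side gets the extra factor (r/p), which is 1 for ζ_p = e^{2πi/p}. *)

(* Defs.v *)
From HB Require Import structures.
From mathcomp Require Import all_boot all_order all_algebra all_field.
From mathcomp Require Import finmap boolp classical_sets cardinality.

Set Implicit Arguments.
Unset Strict Implicit.
Unset Printing Implicit Defensive.

Import Order.TTheory GRing.Theory Num.Theory.
Local Open Scope classical_set_scope.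
Local Open Scope ring_scope.

Definition legendre (a p : nat) : int :=
  if (p %| a)%N then 0
  else if [exists x : 'I_p, x ^ 2 == a %[mod p]] then 1 else -1.

(* None stands for the order +oo of 0. *)
Definition padic_ord (p : nat) (x : rat) : option int :=
  if x == 0 then None
  else Some ((logn p `|numq x|%N)%:Z - (logn p `|denq x|%N)%:Z).

Definition half_integer (x : rat) : Prop := exists n : int, x = n%:~R / 2.

(* K is a subfield of algC, given by its underlying set. *)
Definition integer_ring (K : set algC) : set algC :=
  K `&` [set z | z \in Aint].

Definition nonzero_ideal (K : set algC) (I : set algC) : Prop :=
  [/\ I `<=` integer_ring K,
      exists2 x, I x & x != 0,
      forall x y, I x -> I y -> I (x + y) &
      forall a x, integer_ring K a -> I x -> I (a * x)].

Definition ideal_equiv (K : set algC) (I J : set algC) : Prop :=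
  exists a b, [/\ integer_ring K a /\ a != 0, integer_ring K b /\ b != 0 &
    [set a * x | x in I] = [set b * y | y in J]].

Definition ideal_classes (K : set algC) : set (set (set algC)) :=
  [set [set J | nonzero_ideal K J /\ ideal_equiv K I J]
    | I in [set I | nonzero_ideal K I]].

(* fset_set sends infinite sets to the empty one; this junk value is never
   used when K is a number field, whose class group is finite. *)
Definition class_number (K : set algC) : nat :=
  #|` fset_set (ideal_classes K)|%fset.

Definition quadratic_field (d : int) : set algC :=
  [set z | exists x y : rat, z = ratr x + ratr y * sqrtC d%:~R].

(* exp(2 pi i / n): for n > 1, n.-root (-1) is the n-th root of -1 of least
   nonnegative argument, that is exp(pi i / n). *)
Definition root_of_unity_std (n : nat) : algC := (n.-root (-1)) ^+ 2.

(* The index i : 'I_m stands for i + 1 in 1, ..., m. *)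
Definition C_matrix (p : nat) (zeta : algC) : 'M[algC]_((p - 1) %/ 2) :=
  \matrix_(j, k) ((1 - zeta ^+ (j.+1 ^ 2 * k.+1 ^ 2)) / (1 - zeta ^+ (j.+1 ^ 2))).

Definition S_matrix (p : nat) : 'M[int]_((p - 1) %/ 2) :=
  \matrix_(j, k) legendre (j.+1 ^ 2 + k.+1 ^ 2) p.

(* Main.v *)
Require Import Defs.
From HB Require Import structures.
From mathcomp Require Import all_boot all_order all_algebra all_field.
From mathcomp Require Import perm ring zify.

Import Order.TTheory GRing.Theory Num.Theory.
Local Open Scope ring_scope.

Set Implicit Arguments.
Unset Strict Implicit.
Unset Printing Implicit Defensive.

(** Write [n = (p-1)/2], which is odd, let [Q] be the group of quadratic
    residues modulo [p] (of order [n], not containing [-1]), [T] the quadratic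
    Gauss sum of [zeta], [D] the determinant of the matrix [C], and [S] the
    matrix of Legendre symbols.

    Multiplying each row of [C] by its denominator turns it into [J - Z], where
    [J] is the all-ones matrix and [Z] has the entries [zeta^(j^2 k^2)]; hence
    [D = det (J - Z) / P] with [P] the product of [1 - zeta^x] over [x] in [Q].
    - The sum of [zeta^(t x)] over [x] in [Q] is [((t/p) T - 1) / 2], so that
      [Z^2 = (T/2) S - J/2].  As the all-ones vector is an eigenvector of [Z]
      and [S], this gives [det (J - Z)^2] in terms of [det S].
    - Pairing [x] with [-x] gives [P^2 = - p]: the residues sum to [0], so [P]
      is minus its complex conjugate, and the product of the two is [p].
    Together, [2^n D^2 = (-p)^((p-3)/4) det S (n - T)]
    ([det_C_matrix_sq]).  Replacing [zeta] by [zeta^x] with [x] in [Q] only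
    permutes rows and columns of [J - Z]; averaging over [Q] an expression of
    [D] as an integral polynomial in [zeta] puts [D] in [Q(T)]
    ([det_C_quadratic]), and [T^2 = - p].  Since [D] is an algebraic integer,
    its coordinates [a], [b] are half-integers ([half_integer_Aint]), and
    comparing coordinates in the formula for [D^2] yields the two identities.
    The class number only enters through a sign that multiplies [a] and [b]
    simultaneously, and every other assertion is invariant under this change.

    Valuations: modulo [p] the symbol [((x+y)/p)] is [(x+y)^n], and the binomial
    expansion factors [S] as a product of two Vandermonde matrices and an
    invertible diagonal one; so [p] does not divide [det S]
    ([det_S_matrix_ndvd]).  With [m = (p-3)/4] the identities then say
    [v(a) + v(b) = m] and [v(a^2 - p b^2) = m].  The numbers [2 v(a)] and
    [2 v(b) + 1] have different parities, so their minimum is [m]; the parity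
    of [m] tells which of the two it is.

    The sign in the formula for [a b] is Gauss's determination of [T] for
    [zeta = exp(2 pi i / p)] ([gauss_sum_std]).  Both [T] and the product of
    the differences [zeta^((n+1)k) - zeta^(nk)], for [1 <= k <= n], are square
    roots of [- p].  Which of the two signs relates them is found by reducing a
    polynomial identity modulo [p] and comparing the terms of order [n] at [1].
    The value of the product is found from the positivity of the sines of
    [k pi / p], which has to be derived from the characterization of
    [exp(pi i / p)] as the [p]-th root of [-1] of largest real part in the upper
    half plane ([Im_rootC_pow]). *)

(** * Quadratic residues modulo a prime congruent to 3 modulo 4 *)

Section QuadraticResidues.

Variables (p : nat) (p_prime : prime p) (p_mod4 : p = 3 %[mod 4]).

Local Notation n := ((p - 1) %/ 2)%N.

Lemma p_half : p = (n.*2.+1)%N.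
Proof. by move: p_mod4; lia. Qed.

Lemma half_odd : odd n.
Proof. by move: p_mod4; lia. Qed.

Lemma half_gt0 : (0 < n)%N.
Proof. by have := half_odd; case: n. Qed.

Lemma half_lt : (n < p)%N.
Proof. by have := p_half; lia. Qed.

Lemma natr_Fp_eq0 (k : nat) : (k%:R == 0 :> 'F_p) = (p %| k)%N.
Proof. by rewrite (dvdn_pcharf (pchar_Fp p_prime)). Qed.

Lemma natr_Fp_val (x : 'F_p) : (x : nat)%:R = x.
Proof. exact: natr_Zp. Qed.

Lemma two_Fp_neq0 : 2 != 0 :> 'F_p.
Proof.
by rewrite natr_Fp_eq0 gtnNdvd //; have := p_half; have := half_gt0; lia.
Qed.

Lemma oppr1_Fp_neq1 : -1 != 1 :> 'F_p.
Proof.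
by rewrite -subr_eq0 -opprD oppr_eq0 -[1 + 1]/(2%:R) two_Fp_neq0.
Qed.

Lemma fermat_Fp (x : 'F_p) : x != 0 -> x ^+ n.*2 = 1.
Proof.
move=> x0; apply: (mulfI x0); rewrite -exprS -p_half mulr1.
by have := expf_card x; rewrite card_Fp.
Qed.

(** Euler's criterion is taken as the definition: multiplicativity is then
    immediate, and since [n] is odd an element satisfying it is visibly a
    square (see [quad_res_sqrt]). *)
Definition quad_res (x : 'F_p) : bool := x ^+ n == 1.

Local Notation Q := quad_res.

Lemma quad_res1 : Q 1.
Proof. by rewrite /Q expr1n. Qed.

Lemma quad_res_neq0 (x : 'F_p) : Q x -> x != 0.
Proof.
by apply: contraTneq => ->; rewrite /Q expr0n eqn0Ngt half_gt0 eq_sym oner_eq0.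
Qed.

Lemma quad_res_sq (x : 'F_p) : x != 0 -> Q (x ^+ 2).
Proof. by move=> /fermat_Fp e; rewrite /Q -exprM mul2n e. Qed.

Lemma quad_resM (x y : 'F_p) : Q x -> Q (x * y) = Q y.
Proof. by rewrite /Q exprMn => /eqP ->; rewrite mul1r. Qed.

Lemma quad_resN (x : 'F_p) : x != 0 -> Q (- x) = ~~ Q x.
Proof.
move=> x0; rewrite /Q exprNn -signr_odd half_odd expr1 mulN1r.
have: (x ^+ n) ^+ 2 = 1 by rewrite -exprM muln2 fermat_Fp.
move=> /eqP; rewrite sqrf_eq1 => /orP[] /eqP ->.
  by rewrite eqxx (negbTE oppr1_Fp_neq1).
by rewrite opprK eqxx oppr1_Fp_neq1.
Qed.

(** As [n] is odd, [x = x * x^n = x^(n+1)] is a square as soon as [x^n = 1]. *)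
Lemma quad_res_sqrt (x : 'F_p) : Q x -> (x ^+ n.+1./2) ^+ 2 = x.
Proof.
move=> /eqP e; rewrite -exprM muln2 -[_.*2]/(_.*2) halfK /= half_odd /=.
by rewrite subn0 exprS e mulr1.
Qed.

(** The square root can be taken among the residues, because [-1] is not one;
    this is what lets a Galois conjugation be realized by a permutation of the
    indices. *)
Lemma quad_resP (x : 'F_p) :
  reflect (exists2 y, Q y & x = y ^+ 2) (Q x).
Proof.
apply: (iffP idP) => [qx | [y qy ->]].
  by exists (x ^+ n.+1./2); rewrite ?quad_res_sqrt // /Q exprAC (eqP qx) expr1n.
exact/quad_res_sq/quad_res_neq0.
Qed.

Definition quad_char (x : 'F_p) : int :=
  if x == 0 then 0 else if Q x then 1 else -1.

Lemma legendre_quad_char (a : nat) : legendre a p = quad_char a%:R.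
Proof.
rewrite /legendre /quad_char natr_Fp_eq0; case: ifP => // a0.
congr (if _ then _ else _); apply/existsP/idP => [[x] | /quad_resP[y _ e]].
  have -> : ((x ^ 2 == a %[mod p])%N = ((x : nat)%:R ^+ 2 == a%:R :> 'F_p)).
    by rewrite -natrX -(inj_eq val_inj) /= !val_Fp_nat.
  move=> /eqP e; rewrite -e; apply: quad_res_sq.
  by apply: contraFneq a0 => x0; rewrite -natr_Fp_eq0 -e x0 expr0n.
have yp : (y < p)%N by rewrite -[X in (_ < X)%N](Fp_cast p_prime).
exists (Ordinal yp) => /=; apply/eqP; move: e; rewrite -{1}[y]natr_Fp_val -natrX => /(congr1 val).
by rewrite /= !val_Fp_nat // => ->.
Qed.

(** The Legendre symbol reduces modulo [p] to a power map, which turns matrices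
    of symbols into matrices of polynomial values. *)
Lemma quad_char_Fp (x : 'F_p) : (quad_char x)%:~R = x ^+ n :> 'F_p.
Proof.
rewrite /quad_char; have [-> | x0] := eqVneq x 0.
  by rewrite expr0n eqn0Ngt half_gt0.
have := quad_resN x0; case: ifPn => [/eqP -> // | _].
rewrite /Q exprNn -signr_odd half_odd expr1 mulN1r => /eqP e.
by rewrite -[x ^+ n]opprK e rmorphN.
Qed.

Lemma quad_charM (x y : 'F_p) : quad_char (x * y) = quad_char x * quad_char y.
Proof.
rewrite /quad_char mulf_eq0; have [_ | x0] := eqVneq x 0; first by rewrite mul0r.
have [_ | y0] /= := eqVneq y 0; first by rewrite mulr0.
have [qx | nx] := ifPn (Q x); first by rewrite quad_resM // mul1r.
rewrite -quad_resN // in nx.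
by rewrite -[x * y]opprK quad_resN ?oppr_eq0 ?mulf_neq0 // -mulNr quad_resM //; case: (Q y).
Qed.

Lemma quad_charN (x : 'F_p) : quad_char (- x) = - quad_char x.
Proof.
rewrite /quad_char oppr_eq0; have [_ | x0] := eqVneq x 0; first by rewrite oppr0.
by rewrite quad_resN //; case: (Q x); rewrite ?opprK.
Qed.

Lemma quad_char_sqr (x : 'F_p) : x != 0 -> quad_char x ^+ 2 = 1.
Proof. by rewrite /quad_char => /negbTE ->; case: (Q x). Qed.

Lemma quad_char_res (x : 'F_p) : Q x -> quad_char x = 1.
Proof. by move=> qx; rewrite /quad_char qx (negbTE (quad_res_neq0 qx)). Qed.

Definition sq_ord (j : 'I_n) : 'F_p := (j.+1 ^ 2)%N%:R.

Lemma succ_ord_neq0 (j : 'I_n) : j.+1%:R != 0 :> 'F_p.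
Proof.
by rewrite natr_Fp_eq0 // gtnNdvd //; have := half_lt; have := ltn_ord j; lia.
Qed.

Lemma quad_res_sq_ord (j : 'I_n) : Q (sq_ord j).
Proof. by rewrite /sq_ord natrX quad_res_sq // succ_ord_neq0. Qed.

Lemma sq_ord_add_neq0 (j k : 'I_n) : sq_ord j + sq_ord k != 0.
Proof.
rewrite addr_eq0; apply: contraTneq (quad_res_sq_ord j) => ->.
by rewrite quad_resN ?quad_res_sq_ord //; apply/quad_res_neq0/quad_res_sq_ord.
Qed.

Lemma sq_ord_inj : injective sq_ord.
Proof.
move=> j k /eqP; rewrite /sq_ord !natrX eqf_sqr => /orP[|].
  rewrite -(inj_eq val_inj) /= !val_Fp_nat // !modn_small; first last.
  - by have := p_half; have := ltn_ord j; lia.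
  - by have := p_half; have := ltn_ord k; lia.
  by move=> /eqP [] /val_inj.
rewrite -subr_eq0 opprK -natrD natr_Fp_eq0 gtnNdvd //.
by have := p_half; have := ltn_ord j; have := ltn_ord k; lia.
Qed.

Lemma sq_ord_onto (x : 'F_p) : Q x -> exists j, x = sq_ord j.
Proof.
move=> /quad_resP[y qy ->].
have yp : (y < p)%N by rewrite -[X in (_ < X)%N](Fp_cast p_prime).
have y0 : (0 < y)%N.
  rewrite lt0n; apply: contraNneq (quad_res_neq0 qy) => e.
  exact/eqP/val_inj.
have [ly | gy] := leqP y n.
  have kn : (y.-1 < n)%N by rewrite prednK.
  by exists (Ordinal kn); rewrite /sq_ord /= prednK // natrX natr_Fp_val.
have kn : ((p - y).-1 < n)%N by have := p_half; lia.
exists (Ordinal kn); rewrite /sq_ord /= prednK ?subn_gt0 //.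
by rewrite natrX natrB ?(ltnW yp) // pchar_Fp_0 // sub0r sqrrN natr_Fp_val.
Qed.

(** The indices [1, ..., n] of the matrices enumerate the residues through
    their squares, so that sums and products over indices can be reindexed by
    multiplication in the field. *)
Lemma big_quad_res (R : Type) (idx : R) (op : Monoid.com_law idx) (F : 'F_p -> R) :
  \big[op/idx]_(x | Q x) F x = \big[op/idx]_(k < n) F (sq_ord k).
Proof.
rewrite -(big_imset _ (in2W sq_ord_inj)) /=; apply: eq_bigl => x.
apply/idP/imsetP => [/sq_ord_onto[j ->] | [j _ ->]]; first by exists j.
exact: quad_res_sq_ord.
Qed.

Lemma big_quad_resM (R : Type) (idx : R) (op : Monoid.com_law idx) (F : 'F_p -> R) (y : 'F_p) :
  Q y -> \big[op/idx]_(x | Q x) F (y * x) = \big[op/idx]_(x | Q x) F x.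
Proof.
move=> qy; rewrite [RHS](reindex_inj (mulfI (quad_res_neq0 qy))).
by apply: eq_bigl => x; rewrite quad_resM.
Qed.

Lemma big_neq0_quad_res (R : Type) (idx : R) (op : Monoid.com_law idx) (F : 'F_p -> R) :
  \big[op/idx]_(x | x != 0) F x =
  op (\big[op/idx]_(x | Q x) F x) (\big[op/idx]_(x | Q x) F (- x)).
Proof.
rewrite (bigID Q) /=; congr (op _ _).
  by apply: eq_bigl => x; case: (boolP (Q x)) => [/quad_res_neq0 -> //|_]; rewrite andbF.
rewrite (reindex_inj (@oppr_inj _)); apply: eq_bigl => x.
rewrite oppr_eq0; have [->|x0] := eqVneq x 0.
  by apply/esym/negbTE; apply: contraTN (eqxx 0 : 0 == 0 :> 'F_p) => /quad_res_neq0.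
by rewrite quad_resN // negbK.
Qed.

Lemma card_quad_res : #|[pred x | Q x]| = n.
Proof. by rewrite -sum1_card (big_quad_res _ (fun=> 1%N)) sum1_card card_ord. Qed.

Lemma sum_quad_char : \sum_x quad_char x = 0.
Proof.
have : \sum_x quad_char x = - \sum_x quad_char x.
  rewrite {1}(reindex_inj (@oppr_inj _)) -sumrN.
  by apply: eq_bigr => x _; rewrite quad_charN.
by lia.
Qed.

End QuadraticResidues.

(** * The quadratic Gauss sum *)

Section GaussSums.

Variables (p : nat) (p_prime : prime p) (p_mod4 : p = 3 %[mod 4]).

Local Notation n := ((p - 1) %/ 2)%N.
Local Notation Q := (@quad_res p).

Definition add_char (z : algC) (x : 'F_p) : algC := z ^+ x.

Definition gauss_sum (z : algC) : algC := \sum_x (quad_char x)%:~R * add_char z x.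

Variables (z : algC) (z_prim : p.-primitive_root z).

Local Notation E := (add_char z).
Local Notation T := (gauss_sum z).

Lemma add_char_nat (k : nat) : E k%:R = z ^+ k.
Proof. by rewrite /add_char val_Fp_nat // prim_expr_mod. Qed.

Lemma add_charD (x y : 'F_p) : E (x + y) = E x * E y.
Proof.
by rewrite -[x in LHS]natr_Fp_val -[y in LHS]natr_Fp_val -natrD add_char_nat exprD.
Qed.

Lemma add_char0 : E 0 = 1. Proof. by []. Qed.

Lemma add_char_eq1 (x : 'F_p) : (E x == 1) = (x == 0).
Proof.
by rewrite /add_char -(prim_order_dvd z_prim) -natr_Fp_eq0 // natr_Fp_val.
Qed.

Lemma add_charNV (x : 'F_p) : E x * E (- x) = 1.
Proof. by rewrite -add_charD subrr. Qed.

Lemma add_char_conj (x : 'F_p) : (E x)^* = E (- x).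
Proof.
have E1 : `|E x| = 1.
  apply/eqP; rewrite -(pexpr_eq1 (prime_gt0 p_prime)) // -normrX /add_char exprAC.
  by rewrite (prim_expr_order z_prim) expr1n normr1.
apply: (@mulfI _ (E x)); first by rewrite -normr_eq0 E1 oner_eq0.
by rewrite add_charNV -normCK E1 expr1n.
Qed.

Lemma sum_add_char (t : 'F_p) : \sum_x E (x * t) = if t == 0 then p%:R else 0.
Proof.
case: eqVneq => [-> | t0].
  under eq_bigr do rewrite mulr0 add_char0.
  by rewrite sumr_const card_Fp.
have e : E t * (\sum_x E (x * t)) = \sum_x E (x * t).
  rewrite [RHS](reindex_inj (addrI 1)) mulr_sumr; apply: eq_bigr => x _.
  by rewrite mulrDl mul1r add_charD.
apply/eqP; move/eqP: e; rewrite -subr_eq0 -{2}[\sum_x _]mul1r -mulrBl mulf_eq0.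
by rewrite subr_eq0 add_char_eq1 (negbTE t0).
Qed.

Lemma sum_add_char_neq0 (t : 'F_p) :
  \sum_(x | x != 0) E (x * t) = (if t == 0 then p%:R else 0) - 1.
Proof.
by rewrite -sum_add_char [in RHS](bigD1 0) //= mul0r add_char0 addrAC subrr add0r.
Qed.

Lemma gauss_sum_twist (t : 'F_p) :
  \sum_x (quad_char x)%:~R * E (x * t) = (quad_char t)%:~R * T.
Proof.
have [-> | t0] := eqVneq t 0.
  rewrite {2}/quad_char eqxx mul0r.
  under eq_bigr do rewrite mulr0 add_char0 mulr1.
  by rewrite -rmorph_sum sum_quad_char.
rewrite /gauss_sum mulr_sumr [RHS](reindex_inj (mulIf t0)); apply: eq_bigr => x _.
rewrite quad_charM // rmorphM /= [_ * (quad_char t)%:~R]mulrC !mulrA -intrM -expr2.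
by rewrite quad_char_sqr // mul1r.
Qed.

Lemma gauss_sum_conj : T^* = - T.
Proof.
rewrite /gauss_sum rmorph_sum (reindex_inj (@oppr_inj _)) -sumrN.
apply: eq_bigr => x _; rewrite rmorphM /= add_char_conj opprK quad_charN //.
by rewrite rmorph_int mulrNz mulNr.
Qed.

(** Substituting [y = x t] in the double sum for [T^2] separates the sum over
    [x], which is [p - 1] for [t = -1] and [-1] otherwise. *)
Lemma gauss_sum_sq : T ^+ 2 = - p%:R.
Proof.
have -> : T ^+ 2 = \sum_t \sum_(x | x != 0) (quad_char t)%:~R * E (x * (1 + t)).
  rewrite exchange_big /= expr2 {1}/gauss_sum mulr_suml (bigD1 0) //=.
  rewrite {1}/quad_char eqxx !mul0r add0r; apply: eq_bigr => x x0.
  rewrite /gauss_sum mulr_sumr (reindex_inj (mulfI x0)); apply: eq_bigr => t _ /=.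
  have c2 : (quad_char x)%:~R ^+ 2 = 1 :> algC by rewrite -rmorphXn quad_char_sqr.
  by rewrite quad_charM // mulrDr mulr1 add_charD rmorphM /=; ring: c2.
under eq_bigr do rewrite -mulr_sumr sum_add_char_neq0 mulrBr mulr1.
rewrite sumrB -rmorph_sum sum_quad_char // subr0 (bigD1 (-1)) //= subrr eqxx.
rewrite big1 => [|t]; last by rewrite addrC addr_eq0 => /negbTE ->; rewrite mulr0.
by rewrite addr0 quad_charN // quad_char_res ?quad_res1 // mulN1r.
Qed.

Lemma gauss_sum_neq0 : T != 0.
Proof.
by rewrite -sqrf_eq0 gauss_sum_sq oppr_eq0 pnatr_eq0 -lt0n prime_gt0.
Qed.

(** The sums over residues and over non-residues have sum [-1] and difference
    [(t/p) T]. *)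
Lemma sum_add_char_quad_res (t : 'F_p) : t != 0 ->
  \sum_(x | Q x) E (x * t) = ((quad_char t)%:~R * T - 1) / 2.
Proof.
move=> t0; have := sum_add_char_neq0 t; have := gauss_sum_twist t.
rewrite (bigD1 0) //= {1}/quad_char eqxx mul0r add0r !big_neq0_quad_res //=.
rewrite (negbTE t0) sub0r.
under eq_bigr => x qx do rewrite quad_char_res // mul1r.
under [X in _ + X]eq_bigr => x qx do rewrite quad_charN // quad_char_res // mulN1r.
rewrite sumrN; set A := \sum_(x | Q x) E (x * t); set B := \sum_(x | Q x) E (- x * t).
move=> <- e; have -> : B = -1 - A by rewrite -e; ring.
by field.
Qed.

Lemma prod_1sub_add_char : \prod_(x | x != 0) (1 - E x) = p%:R.
Proof.
have e : \prod_(x : 'F_p | x != 0) ('X - (E x)%:P) = \sum_(i < p) 'X^i.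
  apply: (@mulfI _ ('X - 1%:P)); first by rewrite polyXsubC_eq0.
  rewrite -subrX1 -(factor_Xn_sub_1 z_prim) -[X in index_iota 0 X](Fp_cast p_prime).
  by rewrite big_mkord [RHS](bigD1 0).
move/(congr1 (horner^~ 1)): e; rewrite horner_prod horner_sum.
under eq_bigr do rewrite hornerXsubC.
move=> ->; under eq_bigr do rewrite hornerXn expr1n.
by rewrite sumr_const card_ord.
Qed.

Definition res_prod : algC := \prod_(x | Q x) (1 - E x).

(** Multiplication by the residue [4] preserves the sum, and [3] is invertible
    when [p > 3]. *)
Lemma sum_quad_res : (3 < p)%N -> \sum_(x | Q x) x = 0.
Proof.
move=> p3; have p2 : 2 != 0 :> 'F_p by rewrite two_Fp_neq0.
have := big_quad_resM p_prime p_mod4 +%R id (quad_res_sq p_prime p_mod4 p2).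
rewrite -mulr_sumr; set S := \sum_(x | Q x) x => e.
have : 3 * S = 0 by rewrite -[RHS](subrr S) -{2}e; ring.
move=> /eqP; rewrite mulf_eq0 natr_Fp_eq0 // gtnNdvd //= => /eqP //.
Qed.

(** From [1 - E x = - E x (1 - E (- x))], with [n] odd and the residues summing
    to [0], the product is minus its conjugate.  Their product runs over all
    nonzero [x], and is [p]. *)
Lemma res_prod_sq : (3 < p)%N -> res_prod ^+ 2 = - p%:R.
Proof.
move=> p3; rewrite -prod_1sub_add_char big_neq0_quad_res //= -mulrN expr2.
congr (_ * _).
have -> : res_prod = \prod_(x | Q x) (- E x * (1 - E (- x))).
  apply: eq_bigr => x _.
  by rewrite mulNr mulrBr mulr1 add_charNV opprB.
rewrite big_split /= prodrN card_quad_res // -signr_odd half_odd //.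
have -> : \prod_(x | Q x) E x = 1.
  by rewrite -(big_morph E add_charD add_char0) sum_quad_res.
by rewrite mulr1 expr1 mulN1r.
Qed.

End GaussSums.

(** * The square of the determinant *)

(** Both sides are the determinant of the block matrix with blocks [1], [u],
    [v], [1], computed by eliminating either diagonal block. *)
Lemma det_1sub_mulmx (R : comPzRingType) (m k : nat) (u : 'M[R]_(m, k)) (v : 'M[R]_(k, m)) :
  \det (1%:M - u *m v) = \det (1%:M - v *m u).
Proof.
have eL : block_mx 1%:M u v 1%:M =
    block_mx 1%:M 0 v 1%:M *m block_mx 1%:M u 0 (1%:M - v *m u).
  by rewrite mulmx_block !mulmx0 !mul1mx !mul0mx !mulmx1 !addr0 addrC subrK.
have eR : block_mx 1%:M u v 1%:M =
    block_mx 1%:M u 0 1%:M *m block_mx (1%:M - u *m v) 0 v 1%:M.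
  by rewrite mulmx_block !mulmx0 !mul1mx !mul0mx !mulmx1 !add0r subrK.
have := congr1 determinant eL; rewrite eR !det_mulmx !det_ublock !det_lblock.
by rewrite !det1 !mulr1 !mul1r.
Qed.

Section Determinants.

Variables (p : nat) (p_prime : prime p) (p_mod4 : p = 3 %[mod 4]).

Local Notation n := ((p - 1) %/ 2)%N.
Local Notation Q := (@quad_res p).

Local Notation sq_ord := (@sq_ord p).

Variables (z : algC) (z_prim : p.-primitive_root z).

Local Notation E := (add_char z).
Local Notation T := (gauss_sum p z).
Local Notation S := (map_mx intr (S_matrix p) : 'M[algC]_n).
Local Notation J := (const_mx 1 : 'M[algC]_n).
Local Notation g := ((T - 1) / 2).

Definition char_mx : 'M[algC]_n := \matrix_(j, k) E (sq_ord j * sq_ord k).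

Local Notation Z := char_mx.

Lemma mulmx_char_mx : Z *m Z = (T / 2) *: S - 2^-1 *: J.
Proof.
apply/matrixP => j l; rewrite !mxE.
transitivity (\sum_(x | Q x) E (x * (sq_ord j + sq_ord l))).
  rewrite big_quad_res //=; apply: eq_bigr => k _.
  by rewrite !mxE -add_charD // [sq_ord j * _]mulrC mulrDr.
by rewrite sum_add_char_quad_res ?sq_ord_add_neq0 // legendre_quad_char // natrD; field.
Qed.

Lemma sum_char_mx (j : 'I_n) : \sum_(x | Q x) E (x * sq_ord j) = g.
Proof.
rewrite sum_add_char_quad_res ?(quad_res_neq0 p_prime p_mod4 (quad_res_sq_ord p_prime p_mod4 j)) //.
by rewrite quad_char_res ?quad_res_sq_ord // mul1r.
Qed.

Lemma mulmx_char_ones : Z *m J = g *: J.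
Proof.
apply/matrixP => j l; rewrite !mxE mulr1 -(sum_char_mx j) big_quad_res //=.
by apply: eq_bigr => k _; rewrite !mxE mulr1 mulrC.
Qed.

Lemma mulmx_ones_char : J *m Z = g *: J.
Proof.
apply/matrixP => j l; rewrite !mxE mulr1 -(sum_char_mx l) big_quad_res //=.
by apply: eq_bigr => k _; rewrite !mxE mul1r.
Qed.

Lemma mulmx_ones : J *m J = n%:R *: J.
Proof.
apply/matrixP => j l; rewrite !mxE mulr1.
under eq_bigr do rewrite !mxE mulr1.
by rewrite sumr_const card_ord.
Qed.

Lemma natr_p_half : p%:R = 2 * n%:R + 1 :> algC.
Proof. by rewrite {1}(p_half p_prime p_mod4) -addn1 natrD -muln2 natrM mulrC. Qed.

(** Computing [Z Z J] in two ways determines the row sums of [S]. *)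
Lemma mulmx_S_ones : S *m J = - J.
Proof.
have T0 := gauss_sum_neq0 p_prime p_mod4 z_prim.
have T2 := gauss_sum_sq p_prime p_mod4 z_prim.
have e : (T / 2) *: (S *m J) = (T / 2) *: (- J).
  have := congr1 (fun A => A *m J) mulmx_char_mx.
  rewrite -mulmxA mulmx_char_ones -scalemxAr mulmx_char_ones mulmxBl -!scalemxAl.
  rewrite mulmx_ones => /esym /eqP; rewrite subr_eq => /eqP ->.
  apply/matrixP => j l; rewrite !mxE.
  rewrite natr_p_half in T2; by field: T2.
by apply: scalerI e; rewrite mulf_neq0 // invr_eq0 pnatr_eq0.
Qed.

(** By the previous lemma [S + c J = S (1 - c J)], and [J] has rank one. *)
Lemma det_S_ones (c : algC) : \det (S + c *: J) = \det S * (1 - c * n%:R).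
Proof.
have -> : S + c *: J = S *m (1%:M - (c *: const_mx 1 : 'cV_n) *m (const_mx 1 : 'rV_n)).
  rewrite mulmxBr mulmx1 -scalemxAl -scalemxAr; congr (_ + _).
  have -> : (const_mx 1 : 'cV[algC]_n) *m (const_mx 1 : 'rV_n) = J.
    by apply/matrixP => j l; rewrite !mxE big_ord1 !mxE mulr1.
  by rewrite mulmx_S_ones scalerN opprK.
rewrite det_mulmx; congr (_ * _); rewrite det_1sub_mulmx det_mx11 !mxE.
congr (_ - _); under eq_bigr do rewrite !mxE mul1r mulr1.
by rewrite sumr_const card_ord mulr_natr.
Qed.

(** By the products computed above and [T^2 = - p], the square of [J - Z] is
    [(T/2) (S - (T + 2) J)]. *)
Lemma det_ones_sub_sq :
  \det (J - Z) ^+ 2 = (T / 2) ^+ n * (p%:R + n%:R * T) * \det S.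
Proof.
have T2 := gauss_sum_sq p_prime p_mod4 z_prim.
have -> : \det (J - Z) ^+ 2 = \det ((T / 2) *: (S + (- T - 2) *: J)).
  rewrite expr2 -det_mulmx mulmxBl !mulmxBr mulmx_ones mulmx_ones_char.
  rewrite mulmx_char_ones mulmx_char_mx; congr (\det _).
  apply/matrixP => j l; rewrite !mxE.
  rewrite natr_p_half in T2; by field: T2.
rewrite detZ det_S_ones natr_p_half; ring.
Qed.

Lemma det_C_matrix : \det (C_matrix p z) = \det (J - Z) / res_prod p z.
Proof.
have -> : C_matrix p z = diag_mx (\row_j (1 - E (sq_ord j))^-1) *m (J - Z).
  apply/matrixP => j k; rewrite mul_diag_mx !mxE mulrC.
  by rewrite /sq_ord -natrM !add_char_nat.
rewrite det_mulmx det_diag mulrC; congr (_ * _).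
rewrite /res_prod big_quad_res //= -prodfV.
by apply: eq_bigr => j _; rewrite !mxE.
Qed.

Lemma det_C_matrix_sq : (3 < p)%N ->
  2 ^+ n * \det (C_matrix p z) ^+ 2 =
  (- p%:R) ^+ ((p - 3) %/ 4) * (\det (S_matrix p))%:~R * (n%:R - T).
Proof.
move=> p3; have T2 := gauss_sum_sq p_prime p_mod4 z_prim.
have p0 : p%:R != 0 :> algC by rewrite pnatr_eq0 -lt0n prime_gt0.
rewrite det_C_matrix exprMn exprVn res_prod_sq // det_ones_sub_sq det_map_mx.
have -> : (T / 2) ^+ n = T * (- p%:R) ^+ ((p - 3) %/ 4) / 2 ^+ n.
  rewrite exprMn exprVn -T2 -exprM -exprS; congr (_ ^+ _ / _).
  by move: p_mod4; lia.
set m := ((p - 3) %/ 4)%N; set d := (\det _)%:~R.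
have -> : n%:R - T = T * (p%:R + n%:R * T) / - p%:R.
  by field: T2; exact: p0.
by field; rewrite p0 expf_neq0 ?pnatr_eq0.
Qed.

End Determinants.

(** * The coordinates of the determinant in the quadratic field *)

Section Rationality.

Variables (p : nat) (p_prime : prime p) (p_mod4 : p = 3 %[mod 4]).

Local Notation n := ((p - 1) %/ 2)%N.
Local Notation Q := (@quad_res p).
Local Notation sq_ord := (@sq_ord p).
Local Notation D z := (\det (C_matrix p z)).

Lemma prim_add_char (z : algC) (s : 'F_p) :
  p.-primitive_root z -> s != 0 -> p.-primitive_root (add_char z s).
Proof.
move=> z_prim s0; rewrite /add_char (prim_root_exp_coprime _ z_prim) coprime_sym.
by rewrite prime_coprime // -natr_Fp_eq0 // natr_Fp_val.
Qed.

Lemma add_char_add_char (z : algC) (s x : 'F_p) :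
  p.-primitive_root z -> add_char (add_char z s) x = add_char z (s * x).
Proof.
move=> z_prim; rewrite {1 2}/add_char -exprM -(add_char_nat p_prime z_prim) natrM.
by rewrite !natr_Fp_val.
Qed.

(** Writing [s = y^2] with [y] a residue, the entry of index [(j, k)] of [Z] for
    [zeta^s] has exponent [(y j^2) (y k^2)]: the rows and the columns undergo
    the same permutation, whose sign thus appears squared. *)
Lemma det_C_matrix_galois (z : algC) (s : 'F_p) :
  p.-primitive_root z -> Q s -> D (add_char z s) = D z.
Proof.
move=> z_prim qs.
have zs_prim := prim_add_char z_prim (quad_res_neq0 p_prime p_mod4 qs).
rewrite !det_C_matrix //; congr (_ / _); last first.
  rewrite /res_prod -[RHS](big_quad_resM p_prime p_mod4 _ _ qs) /=.
  by apply: eq_bigr => x _; rewrite add_char_add_char.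
have [y qy ->] := quad_resP p_prime p_mod4 s qs.
have sqF_mul j : exists k, sq_ord k == y * sq_ord j.
  have [|k ->] := @sq_ord_onto _ p_prime p_mod4 (y * sq_ord j); last by exists k.
  by rewrite quad_resM ?quad_res_sq_ord.
have [f /(_ _)/eqP fP] := fin_all_exists sqF_mul.
have f_inj : injective f.
  move=> j k e; apply: (sq_ord_inj p_prime p_mod4).
  by apply: (mulfI (quad_res_neq0 p_prime p_mod4 qy)); rewrite -!fP e.
set M := const_mx 1 - char_mx p z.
have -> : const_mx 1 - char_mx p (add_char z (y ^+ 2)) =
          row_perm (perm f_inj) (col_perm (perm f_inj) M).
  apply/matrixP => j k; rewrite !mxE add_char_add_char // !permE !fP.
  by congr (1 - add_char z _); ring.
rewrite row_permE col_permE !det_mulmx !det_perm odd_permV mulrCA -expr2.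
by rewrite sqrr_sign mulr1.
Qed.

(** The entries of [C] are the geometric sums
    [1 + zeta^(j^2) + ... + zeta^(j^2 (k^2 - 1))]. *)
Definition C_poly : {poly int} :=
  \det (\matrix_(j < n, k < n) \sum_(i < k.+1 ^ 2) 'X^(j.+1 ^ 2 * i)).

Lemma det_C_poly (z : algC) :
  p.-primitive_root z -> D z = (map_poly intr C_poly).[z].
Proof.
move=> z_prim.
rewrite -[RHS]/((horner_eval z \o map_poly intr) C_poly) /C_poly -det_map_mx.
congr (\det _); apply/matrixP => j k; rewrite !mxE /= rmorph_sum /= /horner_eval.
rewrite horner_sum.
have zj : z ^+ (j.+1 ^ 2) != 1.
  rewrite -(prim_order_dvd z_prim) -natr_Fp_eq0 //.
  exact/quad_res_neq0/quad_res_sq_ord.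
rewrite exprM -[1 - _]opprB -[1 - _ in X in _ / X]opprB subrX1 invrN mulrNN.
rewrite mulrC mulKf ?subr_eq0 //; apply: eq_bigr => i _.
by rewrite rmorphXn /= map_polyX hornerXn exprM.
Qed.

Lemma det_C_Aint (z : algC) : p.-primitive_root z -> D z \in Aint.
Proof.
move=> z_prim; rewrite det_C_poly //; apply: rpred_horner.
  by apply/polyOverP => i; rewrite coef_map Aint_int.
exact: Aint_prim_root z_prim.
Qed.

(** [n D] is the sum of the conjugates of [D] over the residues.  Expanding [D]
    as an integral polynomial in [zeta], each power of [zeta] contributes a sum
    of the additive character over residues, which has rational coordinates on
    [1] and [T]. *)
Lemma det_C_quadratic (z : algC) : p.-primitive_root z ->
  exists a b : rat, D z = ratr a + ratr b * gauss_sum p z.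
Proof.
move=> z_prim; set T := gauss_sum p z.
pose c (t : 'F_p) : rat := if t == 0 then n%:R else - 1 / 2.
have avg (t : 'F_p) :
    \sum_(x | Q x) add_char z (x * t) = ratr (c t) + (quad_char t)%:~R / 2 * T.
  rewrite /c; have [-> | t0] := eqVneq t 0.
    rewrite /quad_char eqxx !mul0r addr0 ratr_nat.
    under eq_bigr do rewrite mulr0 add_char0.
    by rewrite sumr_const card_quad_res.
  by rewrite sum_add_char_quad_res // fmorph_div rmorphN rmorph1 rmorph_nat /= -/T; field.
pose C := C_poly.
pose A : rat := \sum_(i < size C) (C`_i)%:~R * c i%:R.
pose B : rat := \sum_(i < size C) (C`_i)%:~R * ((quad_char (i%:R : 'F_p))%:~R / 2).
have e : n%:R * D z = ratr A + ratr B * T.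
  transitivity (\sum_(x | Q x) D (add_char z x)).
    under eq_bigr do rewrite det_C_matrix_galois //.
    by rewrite sumr_const card_quad_res // mulr_natl.
  transitivity (\sum_(x | Q x) \sum_(i < size C) (C`_i)%:~R * add_char z (x * i%:R)).
    apply: eq_bigr => x qx; rewrite det_C_poly; last first.
      by apply: prim_add_char => //; exact: quad_res_neq0 qx.
    rewrite horner_coef size_map_inj_poly ?intr0 //; last exact: intr_inj.
    apply: eq_bigr => i _; rewrite coef_map -(add_char_add_char _ _ z_prim).
    rewrite add_char_nat //.
    by apply: prim_add_char => //; exact: quad_res_neq0 qx.
  rewrite exchange_big /= /A /B !rmorph_sum mulr_suml -big_split /=.
  apply: eq_bigr => i _; rewrite -mulr_sumr avg !rmorphM /= fmorphV /= !ratr_int.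
  by rewrite ratr_nat; ring.
have n0 : n%:R != 0 :> algC by rewrite pnatr_eq0 -lt0n half_gt0.
exists (A / n%:R), (B / n%:R); apply: (mulfI n0); rewrite e !fmorph_div /= !ratr_nat.
by field.
Qed.

Lemma half_integerP (a : rat) : (ratr (2 * a) : algC) \in Num.int -> half_integer a.
Proof.
move=> /intrP[k e]; exists k; have : 2 * a = k%:~R.
  by apply: (fmorph_inj (@ratr algC)); rewrite /= ratr_int -e.
by move=> <-; field.
Qed.

(** The trace of [u = a + b t] is [2 a].  With [x = 2 b], the number
    [u - conj u = x t] is integral, hence so are the rational numbers [p x] and
    [p x^2]; then [p] divides the square of [p x], hence [p x] itself. *)
Lemma half_integer_Aint (a b : rat) (t : algC) :
  t ^+ 2 = - p%:R -> t^* = - t -> ratr a + ratr b * t \in Aint ->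
  half_integer a /\ half_integer b.
Proof.
move=> t2 tN u_int; set u := _ + _ in u_int.
have tA : t \in Aint.
  apply: (@root_monic_Aint ('X^2 + p%:R%:P)).
  - by rewrite rootE !hornerE t2 addNr.
  - by rewrite monicE lead_coefDl ?lead_coefXn // size_polyXn (leq_ltn_trans (size_polyC_leq1 _)).
  - apply/polyOverP => i; rewrite coefD coefXn coefC rpredD ?rpred_nat //.
    by case: ifP; rewrite ?rpred_nat ?rpred0.
have uN : u^* = ratr a - ratr b * t.
  by rewrite /u rmorphD /= (conj_Crat (Crat_rat a)) rmorphM /= tN (conj_Crat (Crat_rat b)) mulrN.
have uA : u^* \in Aint by rewrite Aint_aut.
split; apply: half_integerP.
  have -> : ratr (2 * a) = u + u^* by rewrite uN rmorphM /= ratr_nat /u; ring.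
  apply: Cint_rat_Aint; last exact: rpredD.
  by rewrite uN; apply/CratP; exists (2 * a); rewrite rmorphM /= ratr_nat /u; ring.
set x : algC := ratr (2 * b).
have ux : u - u^* = x * t by rewrite uN /x rmorphM /= ratr_nat /u; ring.
have xA : x * t \in Aint by rewrite -ux rpredB.
have xQ : x \in Crat by exact: Crat_rat.
have [k ek] : exists k : int, p%:R * x = k%:~R.
  apply/intrP/Cint_rat_Aint; first by rewrite rpredM ?rpred_nat.
  by rewrite -[p%:R]opprK -t2 mulNr expr2 -mulrA [t * x]mulrC rpredN rpredM.
have [l el] : exists l : int, p%:R * x ^+ 2 = l%:~R.
  apply/intrP/Cint_rat_Aint; first by rewrite rpredM ?rpredX ?rpred_nat.
  by rewrite -[p%:R]opprK -t2 mulNr -exprMn mulrC rpredN rpredX // [t * x]mulrC.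
have p0 : p%:R != 0 :> algC by rewrite pnatr_eq0 -lt0n prime_gt0.
have ekl : k ^+ 2 = p%:Z * l.
  apply: (@intr_inj algC); rewrite rmorphXn rmorphM /= -ek -el -pmulrn; ring.
have pk : (p %| `|k|)%N.
  have : (p %| `|k| ^ 2)%N by rewrite -abszX ekl abszM dvdn_mulr.
  by rewrite Euclid_dvdX // andbT.
have {pk} : (p%:Z %| k)%Z by rewrite dvdzE.
move=> /dvdzP[q eq]; apply/intrP; exists q; apply: (mulfI p0).
by rewrite ek eq rmorphM /= -pmulrn mulrC.
Qed.

End Rationality.

(** * Valuations at p *)

Lemma logn_addz (p : nat) (x y : int) : prime p -> x != 0 -> y != 0 ->
  (logn p `|x| < logn p `|y|)%N -> logn p `|x + y| = logn p `|x|.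
Proof.
move=> p_prime x0 y0 lt_xy; set e := logn p `|x|.
have dvdE (k : nat) (u : int) : u != 0 -> ((p ^ k)%N%:Z %| u)%Z = (k <= logn p `|u|)%N.
  by move=> u0; rewrite dvdzE /= pfactor_dvdn // absz_gt0.
have xy0 : x + y != 0.
  by rewrite addr_eq0; apply: contraTneq lt_xy => ->; rewrite abszN ltnn.
apply/eqP; rewrite eqn_leq leqNgt -!dvdE //; apply/andP; split; last first.
  by rewrite rpredD // dvdE // ltnW.
apply/negP => dxy; have : ((p ^ e.+1)%N%:Z %| x)%Z.
  by rewrite -(addrK y x) rpredB // dvdE.
by rewrite dvdE // ltnn.
Qed.

Lemma padic_ord_half (p : nat) (k : int) : prime p -> odd p -> k != 0 ->
  padic_ord p (k%:~R / 2) = Some (logn p `|k|)%:Z.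
Proof.
move=> p_prime p_odd k0; rewrite /padic_ord; set a : rat := _ / 2.
have a0 : a != 0 by rewrite mulf_neq0 ?invr_eq0 ?intr_eq0.
rewrite (negbTE a0); congr Some.
have e : k * denq a = 2 * numq a.
  apply: (@intr_inj rat); rewrite !rmorphM /= -[in LHS](mulfVK (_ : 2 != 0) k%:~R) //.
  by rewrite -/a -{1}(divq_num_den a); field; rewrite intr_eq0 denq_neq0.
have := congr1 (fun u : int => logn p `|u|%N) e.
rewrite /= !abszM !lognM ?absz_gt0 ?denq_neq0 ?numq_eq0 //.
rewrite (@logn_coprime p 2) ?coprimen2 //; lia.
Qed.

Section Valuations.

Variables (p : nat) (p_prime : prime p) (p_mod4 : p = 3 %[mod 4]).

Local Notation n := ((p - 1) %/ 2)%N.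
Local Notation sq_ord := (@sq_ord p).

Lemma fact_Fp_neq0 (k : nat) : (k < p)%N -> k`!%:R != 0 :> 'F_p.
Proof.
elim: k => [|k IHk] ltkp; first by rewrite oner_eq0.
by rewrite factS natrM mulf_neq0 ?IHk 1?ltnW // natr_Fp_eq0 // gtnNdvd.
Qed.

(** Modulo [p] the entry of index [(j, k)] is [(u + w)^n] with
    [u = j^2], [w = k^2].  As [u^n = w^n = 1], the first and last terms of the
    binomial expansion are both [1] and [w^(n-i) = w^(-i)]; this exhibits [S] as
    the product of the transposed Vandermonde matrix of the [u]'s, the diagonal
    matrix of the binomial coefficients (with [2] in place of the first one),
    and the Vandermonde matrix of the [w^(-1)]'s. *)
Lemma det_S_matrix_ndvd : ~~ (p %| `|\det (S_matrix p)|)%N.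
Proof.
have -> : (p %| `|\det (S_matrix p)|)%N =
    ((\det (S_matrix p))%:~R == 0 :> 'F_p).
  by rewrite -(dvdz_pcharf (pchar_Fp p_prime)) dvdzE.
rewrite -det_map_mx.
pose x : 'rV['F_p]_n := \row_j sq_ord j.
pose x' : 'rV['F_p]_n := \row_j (sq_ord j)^-1.
pose d : 'rV['F_p]_n := \row_(i < n) ('C(n, i) + (i == 0 :> nat))%:R.
have -> : map_mx intr (S_matrix p) =
    (Vandermonde n x)^T *m diag_mx d *m Vandermonde n x'.
  apply/matrixP => j k; rewrite mul_mx_diag !mxE legendre_quad_char // natrD quad_char_Fp //.
  rewrite -/(sq_ord j) -/(sq_ord k).
  have w0 := quad_res_neq0 p_prime p_mod4 (quad_res_sq_ord p_prime p_mod4 k).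
  have wn : sq_ord k ^+ n = 1 by exact/eqP/quad_res_sq_ord.
  have un : sq_ord j ^+ n = 1 by exact/eqP/quad_res_sq_ord.
  rewrite addrC exprDn big_ord_recr /= subnn expr0 mul1r un binn.
  have n0 := half_gt0 p_prime p_mod4.
  under [RHS]eq_bigr => i _ do rewrite !mxE natrD mulrDr mulrDl.
  rewrite big_split /=; congr (_ + _).
    apply: eq_bigr => i _; rewrite exprB ?unitfE 1?ltnW // wn mul1r exprVn.
    by rewrite -mulr_natr; ring.
  rewrite (bigD1 (Ordinal n0)) //= !expr0 big1 ?addr0 ?mulr1 // => i.
  by rewrite -val_eqE /= => /negbTE ->; rewrite mulr0 mul0r.
rewrite !det_mulmx det_tr det_diag !det_Vandermonde !mulf_neq0 //.
- apply/prodf_neq0 => i _; apply/prodf_neq0 => j lt_ij; rewrite !mxE subr_eq0.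
  by rewrite (inj_eq (sq_ord_inj p_prime p_mod4)) -val_eqE /= gtn_eqF.
- apply/prodf_neq0 => i _; rewrite mxE; have [-> | i0] := eqVneq (val i) 0%N.
    by rewrite bin0 two_Fp_neq0.
  rewrite addn0; have := fact_Fp_neq0 (half_lt p_prime p_mod4); rewrite -(bin_fact (ltnW (ltn_ord i))).
  by rewrite natrM mulf_eq0 negb_or => /andP[].
- apply/prodf_neq0 => i _; apply/prodf_neq0 => j lt_ij; rewrite !mxE subr_eq0.
  by rewrite (inj_eq invr_inj) (inj_eq (sq_ord_inj p_prime p_mod4)) -val_eqE /= gtn_eqF.
Qed.

(** The first identity gives the sum of the two valuations.  In the second one,
    [a^2] and [p b^2] have valuations of opposite parity, so that their
    difference has the smaller of the two as valuation. *)
Lemma padic_ord_components (a b : rat) (s : int) :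
  half_integer a -> half_integer b -> `|s|%N = 1%N ->
  2 ^+ n.+1 * a * b =
    s%:~R * p%:R ^+ ((p - 3) %/ 4) * (\det (S_matrix p))%:~R ->
  2 ^+ n * (a ^+ 2 - p%:R * b ^+ 2) =
    n%:R * (- p%:R) ^+ ((p - 3) %/ 4) * (\det (S_matrix p))%:~R ->
  exists i j : nat,
    [/\ padic_ord p a = Some i%:Z, padic_ord p b = Some j%:Z,
        (i + j = (p - 3) %/ 4)%N & minn i.*2 j.*2.+1 = ((p - 3) %/ 4)%N].
Proof.
move=> [k ->] [l ->] s1; set d := \det _; set m := ((p - 3) %/ 4)%N => e1 e2.
have d_ndvd : ~~ (p %| `|d|)%N := det_S_matrix_ndvd.
have p_odd : odd p by rewrite (p_half p_prime p_mod4) /= odd_double.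
have p0 := prime_gt0 p_prime; have n0 := half_gt0 p_prime p_mod4.
have d0 : d != 0 by apply: contraNneq d_ndvd => ->.
have {}e1 : 2 ^+ n.+1 * k * l = 4 * s * p%:Z ^+ m * d.
  apply: (@intr_inj rat); move: e1.
  rewrite !(rmorphM, rmorphXn) /= -!pmulrn => e1.
  transitivity (4 * (2 ^+ n.+1 * (k%:~R / 2) * (l%:~R / 2)) : rat); first by field.
  by rewrite e1; ring.
have {}e2 : 2 ^+ n * (k ^+ 2 + - (p%:Z * l ^+ 2)) = 4 * n%:Z * (- p%:Z) ^+ m * d.
  apply: (@intr_inj rat); move: e2.
  rewrite !(rmorphM, rmorphXn, rmorphD, rmorphN) /= -!pmulrn => e2.
  transitivity (4 * (2 ^+ n * ((k%:~R / 2) ^+ 2 - p%:R * (l%:~R / 2) ^+ 2)) : rat).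
    by field.
  by rewrite e2; ring.
have logd : logn p `|d| = 0%N by rewrite logn_coprime // prime_coprime.
have log2 : logn p 2 = 0%N by rewrite logn_coprime ?coprimen2.
have log4 : logn p 4 = 0%N by rewrite (lognX p 2 2) log2.
have log_n : logn p n = 0%N.
  by rewrite logn_coprime // prime_coprime // gtnNdvd // half_lt.
have s0 : s != 0 by rewrite -absz_gt0 s1.
have [k0 l0] : k != 0 /\ l != 0.
  apply/andP; rewrite -negb_or -mulf_eq0.
  have : 2 ^+ n.+1 * k * l != 0.
    by rewrite e1 !mulf_neq0 ?expf_neq0 // eqz_nat -lt0n.
  by rewrite -mulrA; apply: contraNneq => ->; rewrite mulr0.
have f1 : (logn p `|k| + logn p `|l| = m)%N.
  have := congr1 (fun u => logn p `|u|%N) e1.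
  rewrite /= !abszM !abszX /= !lognM ?muln_gt0 ?expn_gt0 ?absz_gt0 ?k0 ?l0 ?d0 ?s0 ?p0 //.
  rewrite !lognX s1 logn1 logd log2 (logn_prime _ p_prime) eqxx.
  by rewrite [logn p _ in RHS]log4; lia.
exists (logn p `|k|%N); exists (logn p `|l|%N).
rewrite !padic_ord_half //; split=> //.
have f2 : logn p `|k ^+ 2 + - (p%:Z * l ^+ 2)| = m.
  have := congr1 (fun u => logn p `|u|%N) e2.
  have kl0 : k ^+ 2 + - (p%:Z * l ^+ 2) != 0.
    have : 2 ^+ n * (k ^+ 2 + - (p%:Z * l ^+ 2)) != 0.
      by rewrite e2 !mulf_neq0 ?expf_neq0 ?oppr_eq0 // eqz_nat -lt0n.
    by apply: contraNneq => ->; rewrite mulr0.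
  move: kl0; set u := _ + _ => u0.
  rewrite /= !abszM !abszX /= abszN /= !lognM ?muln_gt0 ?expn_gt0 ?absz_gt0 ?u0 ?d0 ?n0 ?p0 //.
  rewrite !lognX log_n logd log2 (logn_prime _ p_prime) eqxx.
  by rewrite [logn p (1 + _)]log4; lia.
have logk : logn p `|k ^+ 2| = (logn p `|k|).*2 by rewrite abszX lognX mul2n.
have logl : logn p `|- (p%:Z * l ^+ 2)| = (logn p `|l|).*2.+1.
  rewrite abszN abszM abszX /= lognM ?expn_gt0 ?absz_gt0 ?l0 //.
  by rewrite lognX (logn_prime _ p_prime) eqxx mul2n.
have k20 : k ^+ 2 != 0 by rewrite expf_neq0.
have l20 : - (p%:Z * l ^+ 2) != 0.
  by rewrite oppr_eq0 mulf_neq0 ?expf_neq0 // eqz_nat -lt0n.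
have [lt_kl | lt_lk | eq_kl] := ltngtP (logn p `|k|).*2 (logn p `|l|).*2.+1.
- by rewrite -logk -f2 logn_addz // logk logl.
- by rewrite -logl -f2 addrC logn_addz // logk logl.
- by lia.
Qed.

End Valuations.

(** * Position of the powers of exp(pi i / p) *)

(** In angles: if [A] and [B] lie in [(0, pi)] and [A + B > pi], then
    [cos B < - cos (A + B)] and [cos A < - cos B].  Here
    [X = cos A], [Y = sin A], [c = cos B], [s = sin B]. *)
Lemma unit_circle_cross_real (R : numDomainType) (X Y c s : R) :
  X \is Num.real -> c \is Num.real -> X ^+ 2 + Y ^+ 2 = 1 -> c ^+ 2 + s ^+ 2 = 1 ->
  0 < Y -> 0 < s -> X * s + c * Y < 0 -> c < - (X * c - Y * s) /\ X < - c.
Proof.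
move=> rX rc XY cs Y0 s0 lt0.
have Y2 : Y ^+ 2 = 1 - X ^+ 2 by rewrite -XY addrC addKr.
have s2 : s ^+ 2 = 1 - c ^+ 2 by rewrite -cs addrC addKr.
have X1 : 0 < 1 - X.
  rewrite subr_gt0 (le_lt_trans (real_ler_norm rX)) // -(@expr_lt1 _ 2) //.
  by rewrite real_normK // -XY ltrDl exprn_gt0.
split.
  rewrite -subr_gt0 -(pmulr_rgt0 _ X1).
  have -> : (1 - X) * (- (X * c - Y * s) - c) = Y * (s - (X * s + c * Y)).
    by ring: Y2.
  by rewrite pmulr_rgt0 // subr_gt0 (lt_trans lt0).
rewrite -subr_lt0 opprK; have Ys : 0 < Y + s by rewrite addr_gt0.
rewrite -(pmulr_llt0 _ Ys).
have -> : (X + c) * (Y + s) = (X * s + c * Y) * (1 + X * c + Y * s).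
  by ring: Y2 s2.
rewrite nmulr_rlt0 // -(@pmulr_rgt0 _ 2) //.
(* The squared length of the sum of the two points of the circle. *)
have -> : 2 * (1 + X * c + Y * s) = (X + c) ^+ 2 + (Y + s) ^+ 2 by ring: Y2 s2.
by rewrite ltr_wpDl ?exprn_gt0 // real_exprn_even_ge0 // realD.
Qed.

Lemma unit_circle_cross (x w : algC) :
  `|x| = 1 -> `|w| = 1 -> 0 < 'Im x -> 0 < 'Im w -> 'Im (x * w) < 0 ->
  'Re w < 'Re (- (x * w)) /\ 'Re x < - 'Re w.
Proof.
move=> x1 w1 Imx Imw; rewrite raddfN /= ImM ReM => lt0.
have := normC2_Re_Im x; have := normC2_Re_Im w.
rewrite x1 w1 expr1n => /esym cs /esym XY.
exact: unit_circle_cross_real (Creal_Re x) (Creal_Re w) XY cs Imx Imw lt0.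
Qed.

Lemma norm_root_unity (k : nat) (x : algC) : (0 < k)%N -> `|x ^+ k| = 1 -> `|x| = 1.
Proof. by move=> k0 xk; apply/eqP; rewrite -(pexpr_eq1 k0) // -normrX xk. Qed.

(** Follow the powers of [w] until one leaves the upper half plane, say
    [w^(k+1)].  If [k] is odd, its opposite is a [p]-th root of [-1] in the
    upper half plane with a larger real part than [w]; if [k] is even, the same
    holds of the opposite of the conjugate of [w^k].  Either contradicts the
    choice of [w]. *)
Lemma Im_rootC_pow (p k : nat) (w := p.-root (-1) : algC) :
  prime p -> odd p -> p.-primitive_root (w ^+ 2) -> (0 < k < p)%N -> 0 < 'Im (w ^+ k).
Proof.
move=> p_prime p_odd w2_prim; have p0 := prime_gt0 p_prime.
have wp : w ^+ p = -1 by rewrite rootCK.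
have signp : (-1) ^+ p = -1 :> algC by rewrite -signr_odd p_odd.
have w1 : `|w| = 1 by apply: (norm_root_unity p0); rewrite wp normrN1.
have wmax y : y ^+ p = -1 -> 0 < 'Im y -> ~~ ('Re w < 'Re y).
  move=> yp /ltW Imy; rewrite -real_leNgt ?Creal_Re //.
  exact: rootC_Re_max.
have Im_neq0 j : (0 < j < p)%N -> 'Im (w ^+ j) != 0.
  move=> /andP[j0 jp]; apply: contraTneq jp => /eqP; rewrite -leqNgt.
  move=> /eqP/Creal_ImP/CrealP e; apply: dvdn_leq => //.
  rewrite (prim_order_dvd w2_prim) exprAC expr2 -{2}e -normCK.
  by rewrite normrX w1 !expr1n.
have Imw : 0 < 'Im w.
  rewrite lt_neqAle Im_rootC_ge0 ?prime_gt1 // andbT eq_sym.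
  by have := @Im_neq0 1 (prime_gt1 p_prime).
elim: k => [//|k IHk] /andP[_ lt_kp].
have [-> // | k0] := posnP k.
have Imk : 0 < 'Im (w ^+ k) by rewrite IHk // k0 ltnW.
rewrite real_ltNge ?rpred0 // le_eqVlt (negbTE (Im_neq0 _ _)) //=.
apply/negP; rewrite exprSr => lt0.
have wk1 : `|w ^+ k| = 1 by rewrite normrX w1 expr1n.
have [lt1 lt2] := unit_circle_cross wk1 w1 Imk Imw lt0.
have [odd_k | even_k] := boolP (odd k).
  suff /wmax : (- (w ^+ k * w)) ^+ p = -1.
    by rewrite raddfN oppr_gt0 => /(_ lt0); rewrite lt1.
  by rewrite exprNn exprMn exprAC wp signp -signr_odd odd_k; ring.
suff /wmax : (- (w ^+ k)^*) ^+ p = -1.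
  rewrite !raddfN /= Im_conj Re_conj opprK => /(_ Imk).
  by rewrite ltrNr lt2.
rewrite exprNn -rmorphXn /= exprAC wp signp -signr_odd (negbTE even_k).
by rewrite rmorph1 mulr1.
Qed.

(** * The Gauss sum modulo a power of X - 1 *)

Section GaussSign.

Variables (p : nat) (p_prime : prime p) (p_mod4 : p = 3 %[mod 4]).

Local Notation n := ((p - 1) %/ 2)%N.

Lemma poly_geom_Fp : \sum_(i < p) 'X^i = ('X - 1) ^+ p.-1 :> {poly 'F_p}.
Proof.
have X1 : 'X - 1 != 0 :> {poly 'F_p} by rewrite -polyC1 polyXsubC_eq0.
apply: (mulfI X1); rewrite -subrX1 -exprS (prednK (prime_gt0 p_prime)).
have pch : p \in [pchar {poly 'F_p}] by rewrite pchar_poly pchar_Fp.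
have pn : [pchar {poly 'F_p}].-nat p by rewrite (eq_pnat _ (pcharf_eq pch)) pnat_id.
by rewrite exprDn_pchar // exprNn_pchar // expr1n.
Qed.

(** An integral polynomial vanishing at a primitive [p]-th root of unity is a
    multiple of [1 + X + ... + X^(p-1)], which becomes [(X - 1)^(p-1)] modulo
    [p]. *)
Lemma int_poly_root_Fp (z : algC) (f : {poly int}) :
  p.-primitive_root z -> root (map_poly intr f) z ->
  exists q : {poly 'F_p}, map_poly intr f = q * ('X - 1) ^+ p.-1.
Proof.
move=> z_prim fz; have p0 := prime_gt0 p_prime.
pose Phi : {poly int} := \poly_(i < p) 1.
have sPhi : size Phi = p by rewrite size_poly_eq ?oner_neq0.
have mPhi : Phi \is monic by rewrite monicE lead_coef_poly.
have PhiE (R : nzRingType) : map_poly intr Phi = \sum_(i < p) 'X^i :> {poly R}.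
  rewrite /Phi poly_def rmorph_sum /=; apply: eq_bigr => i _.
  by rewrite scale1r map_polyXn.
have Phiz : (map_poly intr Phi).[z] = 0 :> algC.
  have z1 : z - 1 != 0.
    rewrite subr_eq0 -[z]expr1 -(prim_order_dvd z_prim) gtnNdvd //.
    exact: prime_gt1.
  apply: (mulfI z1); rewrite PhiE horner_sum mulr0.
  under eq_bigr do rewrite hornerXn.
  by rewrite -subrX1 (prim_expr_order z_prim) subrr.
have ef := Pdiv.RingMonic.rdivp_eq mPhi f.
have sr : (size (Pdiv.CommonRing.rmodp f Phi) < p)%N.
  by rewrite -[X in (_ < X)%N]sPhi Pdiv.CommonRing.ltn_rmodpN0 // monic_neq0.
move: (Pdiv.CommonRing.rmodp f Phi) sr ef => r sr ef.
have rz : root (map_poly intr r) z.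
  move: fz; rewrite {1}ef !rootE rmorphD rmorphM /= hornerD hornerM Phiz.
  by rewrite mulr0 add0r.
have r0 : r = 0.
  apply: contraTeq sr => r0; rewrite -leqNgt.
  have [m [Em _] dv_m] := minCpolyP z.
  have sm : size m = p.
    rewrite -(size_map_poly (@ratr algC)) -Em (minCpoly_cyclotomic z_prim).
    by rewrite size_cyclotomic totient_prime // prednK.
  have : root (map_poly ratr (map_poly intr r : {poly rat})) z.
    rewrite -map_poly_comp (eq_map_poly (_ : _ =1 intr)) // => x /=.
    exact: ratr_int.
  rewrite dv_m => /dvdp_leq; rewrite sm size_map_inj_poly ?intr0 //; last first.
    exact: intr_inj.
  by apply; rewrite map_poly_eq0_id0 // intr_eq0 lead_coef_eq0.
exists (map_poly intr (Pdiv.CommonRing.rdivp f Phi)).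
by rewrite {1}ef r0 addr0 rmorphM /= PhiE poly_geom_Fp.
Qed.

(** For [i = n] this is the reduction modulo [p] of the polynomial whose value
    at [zeta] is the Gauss sum.  The other exponents interpolate between it and
    [1 + X + ... + X^(p-1)]. *)
Definition power_char_poly (i : nat) : {poly 'F_p} := \sum_(x : 'F_p) (x ^+ i) *: 'X^x.

Lemma power_char_polyS (i : nat) :
  power_char_poly i.+1 = 'X * (power_char_poly i)^`().
Proof.
rewrite /power_char_poly (raddf_sum (@deriv _)) /= mulr_sumr; apply: eq_bigr => x _.
rewrite derivZ derivXn -scalerAr mulrnAr exprSr -scalerA; congr (_ *: _).
rewrite -{1}[x]natr_Fp_val scaler_nat; case: (nat_of_ord x) => [|k] //=.
by rewrite -exprS.
Qed.

(** Each application of the operator [X d/dX] lowers the order of vanishing at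
    [1] by one, and multiplies the leading coefficient there by the former
    order, which is [- (i + 1)] modulo [p]. *)
Lemma power_char_poly_factor (i : nat) : (i < p)%N ->
  exists2 q : {poly 'F_p}, power_char_poly i = ('X - 1) ^+ (p.-1 - i) * q
                         & q.[1] = (-1) ^+ i * i`!%:R.
Proof.
elim: i => [|i IHi] ltip.
  exists 1; last by rewrite hornerC mulr1.
  rewrite mulr1 subn0 -poly_geom_Fp /power_char_poly.
  under eq_bigr do rewrite expr0 scale1r.
  by rewrite -!(big_mkord xpredT (fun i => 'X^i)) Fp_cast.
have [q qE q1] := IHi (ltnW ltip).
have [m em] : exists m, (p.-1 - i = m.+1)%N by exists (p.-1 - i).-1; lia.
have em' : (p.-1 - i.+1 = m)%N by lia.
exists ('X * (m.+1%:R *: q + ('X - 1) * q^`())).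
  rewrite power_char_polyS qE em em' derivM deriv_exp derivB derivX derivC subr0 /=.
  by rewrite -scaler_nat exprS -!mul_polyC; ring.
rewrite !hornerE q1 factS natrM exprS.
have -> : m.+1%:R = - i.+1%:R :> 'F_p.
  apply/eqP; rewrite -subr_eq0 opprK -natrD natr_Fp_eq0 //.
  by rewrite (_ : _ + _ = p)%N //; lia.
by ring.
Qed.

(** The exponents [(n+1)k] and [nk] are [k/2] and [-k/2] modulo [p], so that
    this is, up to sign, the product of the [2 i sin (pi k / p)] when
    [z = exp(2 pi i / p)].  It is defined over any ring in order to be evaluated
    both at roots of unity and at a polynomial variable. *)
Definition diff_prod (R : pzRingType) (z : R) : R :=
  \prod_(k < n) (z ^+ (n.+1 * k.+1) - z ^+ (n * k.+1)).

(** Modulo [p], both sides are values of polynomials vanishing to order [n] at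
    [1], with leading coefficients [(-1)^n n!] and [n!] there.  The difference
    vanishes to order [p - 1 > n], so these agree up to the factor [c]. *)
Lemma gauss_sum_diff_prod_congr (z : algC) (c : int) : p.-primitive_root z ->
  gauss_sum p z = c%:~R * diff_prod z -> c%:~R = -1 :> 'F_p.
Proof.
move=> z_prim eT.
pose f : {poly int} := \sum_(x : 'F_p) (quad_char x) *: 'X^x - c *: diff_prod 'X.
have fz : root (map_poly intr f) z.
  rewrite rootE rmorphB hornerD hornerN rmorph_sum horner_sum /=.
  rewrite map_polyZ hornerZ rmorph_prod horner_prod /=.
  rewrite subr_eq0; apply/eqP; transitivity (gauss_sum p z).
    by apply: eq_bigr => x _; rewrite map_polyZ hornerZ map_polyXn hornerXn.
  rewrite eT; congr (_ * _); apply: eq_bigr => k _.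
  by rewrite rmorphB /= !map_polyXn hornerD hornerN !hornerXn.
have [q] := int_poly_root_Fp z_prim fz.
have n_lt := half_lt p_prime p_mod4; have n0 := half_gt0 p_prime p_mod4.
have [u uE u1] := power_char_poly_factor n_lt.
pose r : {poly 'F_p} := \prod_(k < n) ('X^(n * k.+1) * \sum_(i < k.+1) 'X^i).
have rE : diff_prod ('X : {poly 'F_p}) = ('X - 1) ^+ n * r.
  rewrite -[n in _ ^+ n]card_ord -prodr_const -big_split /=; apply: eq_bigr => k _.
  by rewrite mulrCA -subrX1 mulrBr mulr1 -exprD mulSn addnC.
have r1 : r.[1] = n`!%:R.
  rewrite horner_prod; transitivity (\prod_(k < n) k.+1%:R : 'F_p).
    apply: eq_bigr => k _; rewrite hornerM hornerXn expr1n mul1r horner_sum.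
    under eq_bigr do rewrite hornerXn expr1n.
    by rewrite sumr_const card_ord.
  by rewrite -natr_prod fact_prod big_add1 /= big_mkord.
have -> : map_poly intr f = power_char_poly n - c%:~R *: diff_prod 'X.
  rewrite rmorphB rmorph_sum /= map_polyZ; congr (_ - _ *: _).
    by apply: eq_bigr => x _; rewrite map_polyZ map_polyXn /= quad_char_Fp.
  by rewrite rmorph_prod; apply: eq_bigr => k _; rewrite rmorphB /= !map_polyXn.
have en : (p.-1 - n = n)%N by have := p_half p_prime p_mod4; lia.
have en2 : (p.-1 = n + n)%N by have := p_half p_prime p_mod4; lia.
rewrite uE rE en en2 exprD -mul_polyC.
set A := ('X - 1) ^+ n; set C := c%:~R%:P => eA.
have {eA} e : A * (u - C * r) = A * (q * A).
  by rewrite mulrCA -eA; ring.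
have X1 : ('X - 1) ^+ n != 0 :> {poly 'F_p}.
  by rewrite expf_neq0 // -polyC1 polyXsubC_eq0.
move/(mulfI X1)/(congr1 (horner^~ 1)): e.
rewrite !hornerE u1 r1 subrr expr0n (gtn_eqF n0) mulr0 => /eqP.
rewrite -signr_odd (half_odd p_prime p_mod4) expr1 -mulrBl mulf_eq0.
by rewrite (negbTE (fact_Fp_neq0 p_prime n_lt)) orbF subr_eq0 => /eqP ->.
Qed.

End GaussSign.

(** * The sign of the Gauss sum *)

Lemma prod_sign_imaginary (m : nat) : \prod_(k < m.*2.+1) ((-1) ^+ k.+1 * 'i) = - 'i :> algC.
Proof.
elim: m => [|m IHm]; first by rewrite big_ord1 expr1 mulN1r.
rewrite doubleS big_ord_recr big_ord_recr /= IHm.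
have -> : (-1) ^+ m.*2.+2 = 1 :> algC by rewrite -signr_odd /= odd_double.
have -> : (-1) ^+ m.*2.+3 = -1 :> algC by rewrite -signr_odd /= odd_double.
by rewrite mul1r mulN1r -mulrA mulrN -expr2 sqrCi opprK mulr1.
Qed.

Section SignOfGaussSum.

Variables (p : nat) (p_prime : prime p) (p_mod4 : p = 3 %[mod 4]).

Local Notation n := ((p - 1) %/ 2)%N.

(** The factors of index [k] and [p - k] in the product of the [1 - z^k] over
    [0 < k < p] are conjugate. *)
Lemma prod_norm_1sub (z : algC) : p.-primitive_root z ->
  \prod_(k < n) `|1 - z ^+ k.+1| ^+ 2 = p%:R.
Proof.
move=> z_prim; have ep := p_half p_prime p_mod4.
rewrite -(prod_1sub_add_char p_prime z_prim) /add_char.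
rewrite -(big_mkord (fun i => i != 0%N) (fun i => 1 - z ^+ i)) Fp_cast //.
rewrite [X in \prod_(0 <= i < X | _) _]ep -addnn [RHS]big_mkcond big_nat_recl //= mul1r.
rewrite big_mkord big_split_ord /= [X in _ = _ * X](reindex_inj rev_ord_inj) -big_split /=.
have z1 : `|z| = 1.
  apply: (norm_root_unity (prime_gt0 p_prime)).
  by rewrite (prim_expr_order z_prim) normr1.
apply: eq_bigr => k _; rewrite normCK; congr (_ * _).
rewrite rmorphB rmorph1; congr (1 - _).
have zk0 : z ^+ k.+1 != 0 by rewrite -normr_eq0 normrX z1 expr1n oner_eq0.
apply: (mulfI zk0); rewrite -normCK normrX z1 !expr1n -exprD.
rewrite (_ : (_ + _)%N = p) ?(prim_expr_order z_prim) //.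
by have := ltn_ord k; lia.
Qed.

(** Each factor is [(-1)^k 2 i Im (w^k)], where the imaginary part is positive,
    so the product is determined by its absolute value. *)
Lemma diff_prod_rootC (w := p.-root (-1) : algC) :
  p.-primitive_root (w ^+ 2) -> diff_prod p (w ^+ 2) = - 'i * sqrtC p%:R.
Proof.
move=> z_prim; set z := w ^+ 2 in z_prim *; have p0 := prime_gt0 p_prime.
have ep := p_half p_prime p_mod4.
have p_odd : odd p by rewrite ep /= odd_double.
have wp : w ^+ p = -1 by rewrite rootCK.
have w1 : `|w| = 1 by apply: (norm_root_unity p0); rewrite wp normrN1.
have factorE (k : nat) :
    z ^+ (n.+1 * k) - z ^+ (n * k) = (-1) ^+ k * 'i * (2 * 'Im (w ^+ k)).
  have wk : w ^+ k * (w ^+ k)^* = 1 by rewrite -normCK normrX w1 !expr1n.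
  have wk0 : w ^+ k != 0.
    by apply: contra_eqN wk => /eqP ->; rewrite mul0r eq_sym oner_eq0.
  have -> : z ^+ (n.+1 * k) = (-1) ^+ k * w ^+ k.
    by rewrite -wp -!exprM -exprD; congr (_ ^+ _); rewrite {2}ep; lia.
  have -> : z ^+ (n * k) = (-1) ^+ k * (w ^+ k)^*.
    apply: (mulfI wk0); rewrite mulrCA wk mulr1 -wp -!exprM -exprD.
    by congr (_ ^+ _); rewrite {2}ep; lia.
  rewrite -mulrBr -mulrA; congr (_ * _); rewrite ImE.
  have i2 : 'i ^+ 2 = -1 :> algC by rewrite sqrCi.
  by field: i2.
pose R : algC := \prod_(k < n) (2 * 'Im (w ^+ k.+1)).
have R0 : 0 <= R.
  apply: prodr_ge0 => k _; rewrite mulr_ge0 // ltW // Im_rootC_pow //=.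
  by have := ltn_ord k; lia.
have n_half : n = (n./2.*2.+1)%N.
  by rewrite -{1}[n]odd_double_half (half_odd p_prime p_mod4).
have dE : diff_prod p z = - 'i * R.
  rewrite -(prod_sign_imaginary n./2) -n_half -big_split /=.
  by apply: eq_bigr => k _; rewrite factorE.
rewrite dE; congr (_ * _); rewrite -(prod_norm_1sub z_prim).
have -> : \prod_(k < n) `|1 - z ^+ k.+1| ^+ 2 = R ^+ 2; last by rewrite sqrCK.
rewrite prodrXl -normr_prod.
transitivity (`|diff_prod p z| ^+ 2); last first.
  by rewrite dE normrM normrN normCi mul1r ger0_norm.
rewrite !normr_prod; congr (_ ^+ 2); apply: eq_bigr => k _.
rewrite mulSn exprD -{2}[z ^+ (n * _)]mul1r -mulrBl normrM !normrX w1 !expr1n mulr1.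
by rewrite distrC.
Qed.

(** The Gauss sum and [diff_prod] are square roots of [- p]; they are opposite,
    because [1] and [-1] differ modulo [p]. *)
Lemma gauss_sum_std : p.-primitive_root (root_of_unity_std p) ->
  gauss_sum p (root_of_unity_std p) = 'i * sqrtC p%:R.
Proof.
rewrite /root_of_unity_std => z_prim; set z := _ ^+ 2 in z_prim *.
have dE : diff_prod p z = - 'i * sqrtC p%:R := diff_prod_rootC z_prim.
have : gauss_sum p z ^+ 2 = diff_prod p z ^+ 2.
  by rewrite gauss_sum_sq // dE exprMn sqrrN sqrCi sqrtCK mulN1r.
move/eqP; rewrite eqf_sqr => /orP[/eqP eT | /eqP ->]; last first.
  by rewrite dE mulNr opprK.
have := @gauss_sum_diff_prod_congr _ p_prime p_mod4 z 1 z_prim.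
rewrite mul1r => /(_ eT)/eqP; rewrite eq_sym.
by rewrite (negbTE (oppr1_Fp_neq1 p_prime p_mod4)).
Qed.

Lemma gauss_sum_std_pow (zeta : algC) (r : nat) :
  p.-primitive_root zeta -> zeta = root_of_unity_std p ^+ r ->
  gauss_sum p zeta = (legendre r p)%:~R * ('i * sqrtC p%:R).
Proof.
move=> zeta_prim e; set z := root_of_unity_std p in e.
have zp : z ^+ p = 1.
  by rewrite /z /root_of_unity_std exprAC rootCK ?prime_gt0 // sqrrN expr1n.
have z_prim : p.-primitive_root z.
  have [m z_m m_p] := prim_order_exists (prime_gt0 p_prime) zp.
  have [m1 | m_neq1] := eqVneq m 1%N; last first.
    by rewrite -(prime_nt_dvdP p_prime m_neq1 m_p).
  have z1 : z = 1 by rewrite -(prim_expr_order z_m) m1 expr1.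
  have := prim_order_dvd zeta_prim 1; rewrite e z1 expr1n eqxx dvdn1.
  by rewrite (gtn_eqF (prime_gt1 p_prime)).
rewrite -gauss_sum_std // legendre_quad_char // -gauss_sum_twist // e.
apply: eq_bigr => x _; congr (_ * _).
by rewrite -[x in RHS]natr_Fp_val -natrM add_char_nat // /add_char -exprM mulnC.
Qed.

End SignOfGaussSum.

(** * The determinant formula *)

(** A number and its image under conjugation determine both coordinates. *)
Lemma rat_components (y : algC) (u v u' v' : rat) : y^* = - y -> y != 0 ->
  ratr u + ratr v * y = ratr u' + ratr v' * y -> u = u' /\ v = v'.
Proof.
move=> yN y0 e.
have conjE (a b : rat) : (ratr a + ratr b * y)^* = ratr a - ratr b * y.
  by rewrite rmorphD /= (conj_Crat (Crat_rat a)) rmorphM /= yN (conj_Crat (Crat_rat b)) mulrN.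
have e' := congr1 Num.conj e; rewrite !conjE in e'.
split; apply: (fmorph_inj (@ratr algC)) => /=.
  apply: (@mulfI _ 2); first by rewrite pnatr_eq0.
  transitivity ((ratr u + ratr v * y) + (ratr u - ratr v * y)); first by ring.
  by rewrite e e'; ring.
apply: (mulIf y0); apply: (@mulfI _ 2); first by rewrite pnatr_eq0.
transitivity ((ratr u + ratr v * y) - (ratr u - ratr v * y)); first by ring.
by rewrite e e'; ring.
Qed.

Theorem theorem1 (p : nat) (zeta : algC)
    (p_prime : prime p) (p_mod4 : p = 3 %[mod 4]) (p_gt3 : (3 < p)%N)
    (zeta_prim : p.-primitive_root zeta) :
  exists a b : rat,
    [/\ half_integer a /\ half_integer b,
        \det (C_matrix p zeta) =
          (-1) ^+ ((class_number (quadratic_field (- p%:Z)) + 1) %/ 2)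
          * (ratr a + ratr b * ('i * sqrtC p%:R)),
        (p = 3 %[mod 8] ->
           padic_ord p a = padic_ord p b
           /\ padic_ord p b = Some ((p - 3) %/ 8)%N%:Z)
        /\
        (p = 7 %[mod 8] ->
           padic_ord p a = omap (fun n => n + 1) (padic_ord p b)
           /\ omap (fun n => n + 1) (padic_ord p b) = Some ((p + 1) %/ 8)%N%:Z),
        (* the Legendre factor is 1 for zeta = exp(2 pi i / p); replacing zeta
           by a non-residue power changes the sign of b *)
        forall r : nat, zeta = root_of_unity_std p ^+ r ->
          2 ^+ ((p + 1) %/ 2) * a * b =
            (legendre r p)%:~R * (-1) ^+ ((p + 1) %/ 4) * p%:R ^+ ((p - 3) %/ 4)
            * (\det (S_matrix p))%:~R
      & 2 ^+ ((p - 1) %/ 2) * (a ^+ 2 - p%:R * b ^+ 2) =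
          ((p - 1) %/ 2)%N%:R * (- p%:R) ^+ ((p - 3) %/ 4)
          * (\det (S_matrix p))%:~R].
Proof.
move: ((class_number _ + 1) %/ 2)%N => h; set D := \det _; set y := 'i * _.
set d := \det (S_matrix p); set n := ((p - 1) %/ 2)%N; set m := ((p - 3) %/ 4)%N.
set T := gauss_sum p zeta.
have p0 := prime_gt0 p_prime.
have y2 : y ^+ 2 = - p%:R by rewrite exprMn sqrCi sqrtCK mulN1r.
have T2 : T ^+ 2 = - p%:R := gauss_sum_sq p_prime p_mod4 zeta_prim.
have y0 : y != 0 by rewrite -sqrf_eq0 y2 oppr_eq0 pnatr_eq0 -lt0n.
(* The identities are proved with the sign eps of T; it is identified with the
   Legendre symbol of r at the end. *)
have [eps [eps1 Ty]] : exists eps : int, `|eps|%N = 1%N /\ T = eps%:~R * y.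
  have /eqP := T2; rewrite -y2 eqf_sqr => /orP[] /eqP ->.
    by exists 1; rewrite mul1r.
  by exists (-1); rewrite mulN1r.
have yN : y^* = - y.
  have eps0 : eps%:~R != 0 :> algC by rewrite intr_eq0; lia.
  apply: (mulfI eps0); rewrite mulrN -Ty -(gauss_sum_conj p_prime p_mod4 zeta_prim).
  by rewrite -/T Ty [RHS]rmorphM /= rmorph_int.
have [a0 [b0 eD]] := det_C_quadratic p_prime p_mod4 zeta_prim.
pose s : rat := (-1) ^+ h.
have sC : ratr s = (-1) ^+ h :> algC by rewrite rmorph_sign.
pose a := s * a0; pose b := s * eps%:~R * b0.
have sgn2 : ((-1) ^+ h) ^+ 2 = 1 :> algC by rewrite sqrr_sign.
have eD' : D = (-1) ^+ h * (ratr a + ratr b * y).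
  rewrite /D eD -/T Ty !rmorphM /= sC ratr_int.
  by move: ((-1) ^+ h) sgn2 => u u2; ring: u2.
have [ha hb] : half_integer a /\ half_integer b.
  apply: (half_integer_Aint p_prime y2 yN).
  have -> : ratr a + ratr b * y = (-1) ^+ h * D by rewrite eD'; ring: sgn2.
  by rewrite rpredM ?(det_C_Aint p_prime p_mod4) // rpredX // rpredN.
have e2y : 2 ^+ n * (ratr a + ratr b * y) ^+ 2 = (- p%:R) ^+ m * d%:~R * (n%:R - eps%:~R * y).
  have := det_C_matrix_sq p_prime p_mod4 zeta_prim p_gt3; rewrite -/D -/T Ty -/n -/m -/d.
  by rewrite eD' exprMn sqrr_sign mul1r.
have [eN eab] : 2 ^+ n * (a ^+ 2 - p%:R * b ^+ 2) = n%:R * (- p%:R) ^+ m * d%:~R /\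
    2 ^+ n.+1 * a * b = (- (eps * (-1) ^+ m))%:~R * p%:R ^+ m * d%:~R.
  apply: (rat_components yN y0).
  clearbody a b y n m d.
  have eP : (- p%:R) ^+ m = (-1) ^+ m * p%:R ^+ m :> algC := exprNn _ _.
  transitivity (2 ^+ n * (ratr a + ratr b * y) ^+ 2).
    rewrite !(rmorphM, rmorphB, rmorphXn, ratr_nat) /= !ratr_nat exprS.
    by ring: y2.
  rewrite e2y !(rmorphM, rmorphN, rmorphXn, ratr_nat, ratr_int, rmorph1) /= ?ratr_nat ?ratr_int.
  by rewrite eP; ring.
exists a, b; split; [by [] | exact: eD' | | | exact: eN].
- have s1 : `|- (eps * (-1) ^+ m)|%N = 1%N by rewrite abszN abszM abszX eps1 exp1n.
  have [i [j [-> -> ij mij]]] := padic_ord_components p_prime p_mod4 ha hb s1 eab eN.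
  by split=> p_mod8; split; congr Some; move: p_mod8 ij mij; rewrite -/m /m; lia.
- move=> r er; have := gauss_sum_std_pow p_prime p_mod4 zeta_prim er.
  rewrite -/T Ty => /(mulIf y0)/intr_inj <-.
  have -> : ((p + 1) %/ 2 = n.+1)%N by rewrite /n; move: p_mod4; lia.
  have -> : ((p + 1) %/ 4 = m.+1)%N by rewrite /m; move: p_mod4; lia.
  by rewrite eab exprS rmorphN rmorphM rmorph_sign /=; ring.
Qed.
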